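(* Let $M\in\mathbb F_2^{n\times n}$ be a symmetric matrix and let $u\in\mathbb F_2^n$. If $u=0$, then $\operatorname{null}(M+uu^T)=\operatorname{null}(M)$. Assume $u\neq 0$. Then: (1) If $u\notin\operatorname{Im}(M)$, then \[ \operatorname{null}(M+uu^T)=\operatorname{null}(M)-1\quad\text{and}\quad \operatorname{rank}(M+uu^T)=\operatorname{rank}(M)+1 . \] (2) If $u\in\operatorname{Im}(M)$, choose $y\in\mathbb F_2^n$ with $My=u$. Then the scalar $u^Ty\in\mathbb F_2$ is independent of the choice of $y$, and \[ \operatorname{null}(M+uu^T)=\begin{cases}\operatorname{null}(M), & u^Ty=0,\\ \operatorname{null}(M)+1, & u^Ty=1,\end{cases} \] equivalently \[ \operatorname{rank}(M+uu^T)=\begin{cases}\operatorname{rank}(M), & u^Ty=0,\\ \operatorname{rank}(M)-1, & u^Ty=1.\end{cases} \]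
   Context: All matrices and vector spaces are over the two-element field $\mathbb F_2$. $\operatorname{Im}(M)$ denotes the column space of $M$ and $\operatorname{null}(M)=\dim\ker(M)$. *)

(* Defs.v *)
From HB Require Import structures.
From mathcomp Require Import all_boot all_order all_algebra.

Set Implicit Arguments.
Unset Strict Implicit.
Unset Printing Implicit Defensive.

Import GRing.Theory.
Local Open Scope ring_scope.

(* Matrices act on column vectors, x |-> M *m x, whereas mxalgebra's kermx and
   (_ <= _)%MS are about row vectors; hence the use of subspaces of 'cV. *)
Definition colspace (F : fieldType) (m n : nat) (M : 'M[F]_(m, n)) :
    {vspace 'cV[F]_m} :=
  <<[seq col j M | j : 'I_n]>>%VS.

Definition nullity (F : fieldType) (m n : nat) (M : 'M[F]_(m, n)) : nat :=
  \dim (lker (linfun (mulmx M : 'cV[F]_n -> 'cV[F]_m))).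

(* Main.v *)
(* The row space of N = M + u u^T lies in that of M plus the line of u^T.
   If u is not in Im(M), some x has M x = 0 and u^T x <> 0, so N x is a nonzero
   multiple of u and the inclusion is an equality.  If u = M y, then N y = (1 + u^T y) u: when
   1 + u^T y is nonzero, M and N have the same row space; when it is zero, y is
   a kernel vector of N that is not in ker(M), while ker(M) is contained in
   ker(N), and the rank drops by exactly one. *)

Require Import Defs.
From HB Require Import structures.
From mathcomp Require Import all_boot all_order all_algebra.

Import GRing.Theory.
Local Open Scope ring_scope.

Lemma colspaceP (F : fieldType) (m n : nat) (M : 'M[F]_(m, n)) (u : 'cV[F]_m) :
  reflect (exists y : 'cV[F]_n, M *m y = u) (u \in colspace M).
Proof.
apply: (iffP idP) => [uM|[y <-]].
  pose f : 'Hom('cV[F]_n, 'cV[F]_m) := linfun (mulmx M).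
  have /subvP/(_ u uM)/memv_imgP[y _ ->] : (colspace M <= limg f)%VS.
    apply/span_subvP => _ /imageP[j _ ->].
    by rewrite colE -[M *m _](lfunE (mulmx M)) memv_img ?memvf.
  by exists y; rewrite lfunE.
have -> : M *m y = \sum_j y j 0 *: col j M.
  apply/matrixP => i k; rewrite mxE summxE; apply: eq_bigr => j _.
  by rewrite !mxE mulrC (ord1 k).
by apply: memv_suml => j _; apply/memvZ/memv_span/image_f.
Qed.

(* Transposition embeds the row space of [kermx M^T] into 'cV as ker(M). *)
Lemma nullityE (F : fieldType) (m n : nat) (M : 'M[F]_(m, n)) :
  nullity M = (n - \rank M)%N.
Proof.
rewrite -(mxrank_tr M) -mxrank_ker.
set K := kermx M^T; set B := row_base K.
pose g : 'Hom('rV[F]_(\rank K), 'cV[F]_n) := linfun (trmx \o mulmxr B).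
have gE v : g v = (v *m B)^T by rewrite lfunE.
have -> : \rank K = \dim {:'rV[F]_(\rank K)} by rewrite dimvf /dim /= mul1n.
(* [g] is injective because the rows of [B] are free; it remains to identify its image with
   ker(M). *)
rewrite -(@limg_dim_eq _ _ _ g); last first.
  apply/eqP; rewrite -subv0 capfv; apply/subvP => v.
  rewrite memv_ker memv0 gE -[0]trmx0 (inj_eq trmx_inj) -(mul0mx _ B).
  by rewrite (inj_eq (row_free_inj (row_base_free K))).
congr (\dim _); apply/vspaceP => x.
rewrite memv_ker lfunE /= -(inj_eq trmx_inj) trmx_mul trmx0.
transitivity (x^T <= B)%MS; first by rewrite eq_row_base; apply/eqP/sub_kermxP.
apply/submxP/memv_imgP => [[v xE]|[v _ ->]]; exists v.
- exact: memvf.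
- by rewrite gE -xE trmxK.
- by rewrite gE trmxK.
Qed.

Section SymmetricRankOneUpdate.

Variables (F : fieldType) (n : nat) (M : 'M[F]_n) (u : 'cV[F]_n).
Hypothesis symM : M^T = M.

Let N := M + u *m u^T.

Let symN : N^T = N.
Proof. by rewrite linearD /= trmx_mul trmxK symM. Qed.

Let tr_mulM (y : 'cV[F]_n) : y^T *m M = (M *m y)^T.
Proof. by rewrite trmx_mul symM. Qed.

Let updateE (y : 'cV[F]_n) : N *m y = M *m y + (u^T *m y) 0 0 *: u.
Proof. by rewrite mulmxDl -mulmxA [u^T *m y]mx11_scalar mul_mx_scalar !mxE. Qed.

Let sub_update : (N <= M + u^T)%MS.
Proof. by rewrite addmx_sub_adds // submxMl. Qed.

Let sub_update_inv : (M <= N + u^T)%MS.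
Proof.
have -> : M = N - u *m u^T by rewrite addrK.
by rewrite addmx_sub_adds // -mulNmx submxMl.
Qed.

(** Since [N] is symmetric, transposing the hypothesis gives y^T N = c u^T, and c can be divided
    out. *)
Let update_sub_row y c : N *m y = c *: u -> c != 0 -> (u^T <= N)%MS.
Proof.
move=> Ny c0; apply/submxP; exists (c^-1 *: y^T).
apply/trmx_inj; rewrite trmx_mul symN linearZ /= !trmxK -scalemxAr Ny.
by rewrite scalerA mulVf // scale1r.
Qed.

Lemma rank_update_notin : u \notin colspace M -> \rank N = (\rank M).+1.
Proof.
move=> uM.
have nuM : ~~ (u^T <= M)%MS.
  apply: contra uM => /submxP[v uv]; apply/colspaceP; exists v^T.
  by apply/trmx_inj; rewrite -tr_mulM trmxK.
have uN : (u^T <= N)%MS.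
  (* The columns of [cokermx M] lie in ker(M), and [u^T] kills all of them only if it is in the row
     space of [M]. Column j is the wanted x. *)
  have /matrix0Pn[i [j uKj]] : u^T *m cokermx M != 0 by rewrite -submxE.
  rewrite {i}(ord1 i) in uKj.
  apply: (@update_sub_row (col j (cokermx M)) ((u^T *m cokermx M) 0 j)) => //.
  by rewrite updateE colE (mulmxA M) mulmx_coker mul0mx add0r
    (mulmxA u^T) -colE mxE.
have -> : \rank N = \rank (M + u^T)%MS.
  apply: eqmx_rank; rewrite sub_update addsmx_sub uN andbT.
  by rewrite (submx_trans sub_update_inv) // addsmx_sub submx_refl.
(* Adding one row raises the rank by at most one, and strictly because [u^T] is not in the row space
   of [M]. *)
apply/eqP; rewrite eqn_leq; apply/andP; split.
  apply: leq_trans (mxrank_adds_leqif _ _) _.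
  by rewrite -[leqRHS]addn1 leq_add2l rank_leq_row.
by apply: rank_ltmx; rewrite ltmxE addsmxSl addsmx_sub submx_refl.
Qed.

Lemma rank_update_neq0 y :
  M *m y = u -> 1 + (u^T *m y) 0 0 != 0 -> \rank N = \rank M.
Proof.
move=> My c0.
have uM : (u^T <= M)%MS by rewrite -My -tr_mulM submxMl.
have uN : (u^T <= N)%MS.
  by apply: (@update_sub_row y _ _ c0); rewrite updateE My scalerDl scale1r.
apply/eqP; rewrite eqn_leq; apply/andP; split; apply: mxrankS.
  by rewrite (submx_trans sub_update) // addsmx_sub submx_refl.
by rewrite (submx_trans sub_update_inv) // addsmx_sub submx_refl.
Qed.

Lemma rank_update_eq0 y :
  M *m y = u -> u != 0 -> 1 + (u^T *m y) 0 0 = 0 -> (\rank N).+1 = \rank M.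
Proof.
move=> My u0 c0.
have Ny : N *m y = 0.
  by rewrite updateE My -[X in X + _]scale1r -scalerDl c0 scale0r.
apply/eqP; rewrite eqn_leq; apply/andP; split; last first.
  apply: leq_trans (mxrankS sub_update_inv) _.
  apply: leq_trans (mxrank_adds_leqif _ _) _.
  by rewrite -[leqRHS]addn1 leq_add2l rank_leq_row.
(* In terms of left kernels: v M = 0 gives v u = v M y = 0, hence v N = 0. The inclusion is strict,
   since y^T N = 0 while y^T M = u^T is nonzero. *)
have kerMN : (kermx M < kermx N)%MS.
  rewrite ltmxE; apply/andP; split.
    apply/sub_kermxP; rewrite mulmxDr mulmx_ker -My add0r.
    by rewrite mulmxA [kermx M *m _]mulmxA mulmx_ker !mul0mx.
  apply/negP => /(submx_trans _) sub.
  have /sub : (y^T <= kermx N)%MS.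
    by apply/sub_kermxP; rewrite -symN -trmx_mul Ny trmx0.
  by move/sub_kermxP/eqP; rewrite tr_mulM My trmx_eq0; apply/negP.
have := rank_ltmx kerMN; rewrite !mxrank_ker.
by apply: contraTT; rewrite -!leqNgt; apply: leq_sub2l.
Qed.

End SymmetricRankOneUpdate.

Theorem theorem1p3 (n : nat) (M : 'M['F_2]_n) (u : 'cV['F_2]_n)
    (symM : M^T = M) :
  (u = 0 -> nullity (M + u *m u^T) = nullity M) /\
  (u <> 0 ->
    (u \notin colspace M ->
       (nullity (M + u *m u^T))%:Z = (nullity M)%:Z - 1 /\
       \rank (M + u *m u^T)%R = (\rank M + 1)%N) /\
    (u \in colspace M ->
       (exists y : 'cV['F_2]_n, M *m y = u) /\
       (forall y y' : 'cV['F_2]_n, M *m y = u -> M *m y' = u ->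
          (u^T *m y) 0 0 = (u^T *m y') 0 0) /\
       (forall y : 'cV['F_2]_n, M *m y = u ->
          ((u^T *m y) 0 0 = 0 -> nullity (M + u *m u^T) = nullity M) /\
          ((u^T *m y) 0 0 = 1 ->
             nullity (M + u *m u^T) = (nullity M + 1)%N) /\
          ((u^T *m y) 0 0 = 0 -> \rank (M + u *m u^T)%R = \rank M) /\
          ((u^T *m y) 0 0 = 1 ->
             (\rank (M + u *m u^T)%R)%:Z = (\rank M)%:Z - 1)))).
Proof.
(* These bounds keep the natural subtractions n - rank from truncating. *)
have rM := rank_leq_row M; have rN := rank_leq_row (M + u *m u^T).
split=> [->|/eqP u0]; first by rewrite mul0mx addr0.
split=> [uM|/colspaceP exy].
  have r := rank_update_notin _ _ _ _ symM uM; rewrite !nullityE r addn1.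
  split=> //; rewrite r in rN.
  by rewrite -subzn // -subzn // -addn1 PoszD opprD addrA.
split=> //; split=> [y y' <- My'|y My].
  (* With u = M y, symmetry turns the two scalars into y^T (M y) and y^T (M y'), and M y' = M y. *)
  by rewrite trmx_mul symM -!mulmxA My'.
have r0 : (u^T *m y) 0 0 = 0 -> \rank (M + u *m u^T)%R = \rank M.
  by move=> c0; apply: (rank_update_neq0 _ _ _ _ symM _ My); rewrite c0.
have r1 : (u^T *m y) 0 0 = 1 -> (\rank (M + u *m u^T)%R).+1 = \rank M.
  move=> c1; apply: (rank_update_eq0 _ _ _ _ symM _ My u0).
  (* In ['F_2], 1 + 1 = 0 by computation on representatives. *)
  by rewrite c1; apply: val_inj.
split=> [/r0 r|]; first by rewrite !nullityE r.
split=> [/r1 r|]; first by rewrite !nullityE -r addn1 subnSK ?r.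
by split=> // /r1 <-; rewrite intS addrAC subrr add0r.
Qed.
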